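(* Let $N\ge 3$, let $\Omega\subset\mathbb{R}^N$ be a domain, and let $b,c\in C(\Omega)$ be real-valued functions with $c\ge 0$ in $\Omega$. Suppose there exists $u\in C^2(\Omega)$ with $u>0$ in $\Omega$ and $$-\Delta u+b(x)|\nabla u|\ \ge\ c(x)\,u\quad\text{pointwise in }\Omega .$$ Then for every $\phi\in C_c^\infty(\Omega)$, $$\sqrt{\int_\Omega c\,\phi^2\,dx}\ \le\ \sqrt{\int_\Omega|\nabla\phi|^2\,dx}+\sqrt{\int_\Omega\frac{b^2}{4}\phi^2\,dx},$$ or, equivalently, $$\int_\Omega\Big(c-\frac{b^2}{4}\Big)\phi^2\,dx\ \le\ \int_\Omega|\nabla\phi|^2\,dx+2\sqrt{\int_\Omega|\nabla\phi|^2\,dx\,\int_\Omega\frac{b^2}{4}\phi^2\,dx}.$$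
   Context: A domain is a nonempty connected open set. The function $u$ in the statement is called a positive (classical) supersolution of $-\Delta u+b(x)|\nabla u|=c(x)u$ in $\Omega$. *)

(* Defs.v *)
From HB Require Import structures.
From mathcomp Require Import all_boot all_order all_algebra.
From mathcomp Require Import all_classical all_reals all_analysis.

Set Implicit Arguments.
Unset Strict Implicit.
Unset Printing Implicit Defensive.

Import Order.TTheory GRing.Theory Num.Theory.
Import numFieldNormedType.Exports.

Local Open Scope classical_set_scope.
Local Open Scope ring_scope.

(* Row vectors carry the product sigma-algebra, i.e. the one generated by the
   coordinates, as [n.-tuple T] does in the library; for T := R it is the Borel
   sigma-algebra of 'rV[R]_n. *)
Section measurable_rV.
Context {d} {T : measurableType d}.
Variable n : nat.

Let coors : 'I_n -> 'rV[T]_n -> T := fun i x => x ord0 i.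

Let rV_set0 : g_sigma_preimage coors set0.
Proof. exact: sigma_algebra0. Qed.

Let rV_setC A : g_sigma_preimage coors A -> g_sigma_preimage coors (~` A).
Proof. exact: sigma_algebraC. Qed.

Let rV_bigcup (F : _^nat) : (forall i, g_sigma_preimage coors (F i)) ->
  g_sigma_preimage coors (\bigcup_i (F i)).
Proof. exact: sigma_algebra_bigcup. Qed.

HB.instance Definition _ := @isMeasurable.Build (measure_tuple_display d)
  'rV[T]_n (g_sigma_preimage coors) rV_set0 rV_setC rV_bigcup.

End measurable_rV.

Lemma measurable_rV_coord d (T : measurableType d) n (i : 'I_n) :
  measurable_fun [set: 'rV[T]_n] (fun x : 'rV[T]_n => x ord0 i).
Proof.
move=> _ Y mY; rewrite setTI; apply: sub_sigma_algebra => /=.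
rewrite -bigcup_seq/=; exists i => /=; first by rewrite mem_index_enum.
by exists Y => //; rewrite setTI.
Qed.

Lemma measurable_fun_rVP d1 d2 (T1 : measurableType d1) (T2 : measurableType d2)
    n (f : T1 -> 'rV[T2]_n) :
  measurable_fun [set: T1] f <->
  forall i, measurable_fun [set: T1] (fun x => f x ord0 i).
Proof.
split=> [mf i|mf].
  exact: (measurableT_comp (measurable_rV_coord i) mf).
apply: measurability => //.
move=> _ [A + <-]; rewrite -bigcup_seq/= => -[i _ [B mB <-]].
by rewrite setTI; exact: mf.
Qed.

Definition rV_cons (T : Type) n (p : T * 'rV[T]_n) : 'rV[T]_n.+1 :=
  row_mx (const_mx p.1 : 'rV[T]_1) p.2.

Lemma measurable_rV_cons d (T : measurableType d) n :
  measurable_fun [set: T * 'rV[T]_n] (@rV_cons T n).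
Proof.
apply/measurable_fun_rVP => i.
case: (@split_ordP 1 n i) => j -> /=.
- rewrite (_ : (fun _ => _) = fst); first exact: measurable_fst.
  by apply/funext => x; apply: etrans (row_mxEl _ _ _ _) _; rewrite mxE.
- rewrite (_ : (fun _ => _) = fun x : T * 'rV[T]_n => x.2 ord0 j).
    exact: (measurableT_comp (measurable_rV_coord j) measurable_snd).
  by apply/funext => x; exact: (row_mxEr (const_mx x.1)).
Qed.

Section lebesgue_rV.
Variable R : realType.
Local Open Scope ereal_scope.

(* n-fold product of the Lebesgue measure, transported along
   R * 'rV[R]_n ~ 'rV[R]_n.+1; lebesgue_rV_box below gives its value on boxes. *)
Fixpoint lebesgue_rV n : set 'rV[R]_n -> \bar R :=
  if n is m.+1 then
    pushforward (@lebesgue_measure R \x @lebesgue_rV m) (@rV_cons R m)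
  else \d_ (0%R : 'rV[R]_0).

Let rV_coords n (x : 'rV[R]_n.+1) : measurableTypeR R * 'rV[R]_n :=
  (x ord0 ord0, rsubmx (x : 'rV[R]_(1 + n))).

Let rV_consK n : cancel (@rV_cons R n) (@rV_coords n).
Proof.
move=> [a v]; rewrite /rV_coords /rV_cons /= row_mxKr; congr (_, _).
have -> : ord0 = lshift n (ord0 : 'I_1) by apply/val_inj.
by apply: etrans (row_mxEl _ _ _ _) _; rewrite mxE.
Qed.

Let rV_coordsK n : cancel (@rV_coords n) (@rV_cons R n).
Proof.
move=> x; rewrite /rV_coords /rV_cons /=.
apply: etrans (hsubmxK (x : 'rV[R]_(1 + n))); congr row_mx.
by apply/rowP => i; rewrite !mxE (ord1 i); congr (x _ _); exact/val_inj.
Qed.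

Let measurable_rV_coords n : measurable_fun setT (@rV_coords n).
Proof.
apply/measurable_fun_pairP; split.
  exact: (@measurable_rV_coord _ (measurableTypeR R)).
apply/measurable_fun_rVP => i /=.
rewrite (_ : (fun _ => _) = fun x : 'rV[R]_n.+1 => x ord0 (rshift 1 i)).
  exact: measurable_rV_coord.
by apply/funext => x; rewrite mxE.
Qed.

Let lebesgue_rV_sfm n : exists m : {sigma_finite_measure set 'rV[R]_n -> \bar R},
  m = @lebesgue_rV n :> (set 'rV[R]_n -> \bar R).
Proof.
elim: n => [|n [m mE]] /=; first by exists \d_ (0%R : 'rV[R]_0).
rewrite -mE.
have mc : measurable_fun [set: measurableTypeR R * 'rV[R]_n] (@rV_cons R n).
  exact: (@measurable_rV_cons _ (measurableTypeR R)).
have [nu nuE] : exists nu : {measure set 'rV[R]_n.+1 -> \bar R},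
    nu = pushforward (@lebesgue_measure R \x m) (@rV_cons R n)
      :> (set _ -> \bar R).
  by unshelve eexists (pushforward (@lebesgue_measure R \x m) (@rV_cons R n)).
have sf : sigma_finite setT nu.
  have /sigma_finiteP[F [TF ndF Foo]] := sigma_finiteT (@lebesgue_measure R).
  have /sigma_finiteP[G [TG ndG Goo]] := sigma_finiteT m.
  exists (fun k => @rV_coords n @^-1` (F k `*` G k)).
    rewrite -preimage_bigcup (_ : \bigcup_k _ = setT) ?preimage_setT//.
    rewrite -setXTT TF TG; apply/seteqP; split => -[x y].
      by move=> [k _ [Fx Gy]]; split; exists k.
    move=> [[k _ /= Fx] [l _ /= Gy]]; exists (maxn k l) => //; split => /=.
      by move: x Fx; exact/subsetPset/ndF/leq_maxl.
    by move: y Gy; exact/subsetPset/ndG/leq_maxr.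
  move=> k; have [mF Fkoo] := Foo k; have [mG Gkoo] := Goo k; split.
    rewrite -[X in measurable X]setTI; apply: measurable_rV_coords => //.
    exact: measurableX.
  rewrite nuE /= /pushforward -comp_preimage.
  rewrite (_ : _ \o _ = idfun); last by rewrite funeqE => x /=; rewrite rV_consK.
  by rewrite preimage_id product_measure1E// lte_mul_pinfty// ge0_fin_numE.
pose sfm := isSFinite.Build _ _ _ _ (sfinite_measure_sigma_finite sf).
pose sgf := isSigmaFinite.Build _ _ _ _ sf.
pose nu' := HB.pack_for {sigma_finite_measure set 'rV[R]_n.+1 -> \bar R}
  (Measure.sort nu) sfm sgf.
by exists nu'; rewrite -nuE.
Qed.

Let lebesgue_rV0 n : @lebesgue_rV n set0 = 0.
Proof. by have [m <-] := lebesgue_rV_sfm n; exact: measure0. Qed.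

Let lebesgue_rV_ge0 n A : 0 <= @lebesgue_rV n A.
Proof. by have [m <-] := lebesgue_rV_sfm n; exact: measure_ge0. Qed.

Let lebesgue_rV_semi_sigma_additive n : semi_sigma_additive (@lebesgue_rV n).
Proof.
by have [m <-] := lebesgue_rV_sfm n; exact: measure_semi_sigma_additive.
Qed.

HB.instance Definition _ n := isMeasure.Build _ _ _ (@lebesgue_rV n)
  (lebesgue_rV0 n) (@lebesgue_rV_ge0 n) (@lebesgue_rV_semi_sigma_additive n).

Let lebesgue_rV_sigma_finite n : sigma_finite setT (@lebesgue_rV n).
Proof. by have [m <-] := lebesgue_rV_sfm n; exact: sigma_finiteT. Qed.

HB.instance Definition _ n := Measure_isSigmaFinite.Build _ _ _ (@lebesgue_rV n)
  (lebesgue_rV_sigma_finite n).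

Lemma lebesgue_rV_box n (A : 'I_n -> set R) :
  (forall i, measurable (A i)) ->
  lebesgue_rV [set x : 'rV[R]_n | forall i, A i (x ord0 i)] =
  \prod_(i < n) lebesgue_measure (A i : set (measurableTypeR R)).
Proof.
elim: n A => [|n IHn] A mA.
  rewrite big_ord0 /= diracE mem_set// => -[].
  by case.
rewrite big_ord_recl -IHn//= -product_measure1E; last 2 first.
- exact: mA.
- rewrite (_ : mkset _ = \bigcap_(i in [set: 'I_n])
      (fun x : 'rV[R]_n => x ord0 i) @^-1` A (lift ord0 i)).
    apply: fin_bigcap_measurable => [|i _]; first exact: finite_finset.
    by rewrite -[X in measurable X]setTI; exact: measurable_rV_coord.
  by apply/seteqP; split => [x Ax i _|x Ax i]; exact: Ax.
rewrite /pushforward; congr (_ _); apply/seteqP.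
have cons0 x : @rV_cons R n x ord0 ord0 = x.1 by exact: (congr1 fst (rV_consK x)).
have consS x i : @rV_cons R n x ord0 (lift ord0 i) = x.2 ord0 i.
  rewrite (_ : lift _ _ = rshift 1 i); last exact/val_inj.
  exact: (row_mxEr (const_mx x.1)).
split => [x Ax|x [/= A0 AS] i] /=.
  by split=> [|i] /=; [rewrite -cons0|rewrite -consS]; exact: Ax.
by case: (unliftP ord0 i) => [k|] ->; rewrite ?cons0 ?consS.
Qed.

End lebesgue_rV.

Arguments lebesgue_rV {R n}.

Definition domain (R : realType) n (A : set 'rV[R]_n) : Prop :=
  [/\ A !=set0, open A & connected A].

(* The canonical norm of 'rV[R]_n is the maximum norm, not the Euclidean one. *)
Definition enorm (R : realType) n (v : 'rV[R]_n) : R :=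
  Num.sqrt (\sum_(i < n) v ord0 i ^+ 2).

Definition partial (R : realType) n (i : 'I_n) (f : 'rV[R]_n -> R) :
    'rV[R]_n -> R :=
  fun x => 'D_(delta_mx ord0 i) f x.

Definition gradient (R : realType) n (f : 'rV[R]_n -> R) (x : 'rV[R]_n) :
    'rV[R]_n :=
  \row_(i < n) partial i f x.

Definition laplacian (R : realType) n (f : 'rV[R]_n -> R) (x : 'rV[R]_n) : R :=
  \sum_(i < n) partial i (partial i f) x.

(* f is of class C^k on A, for A open: all iterated partial derivatives of order
   at most k exist and are continuous on A.  As A is open, only the values of f
   on A matter. *)
Fixpoint class_C (R : realType) n (k : nat) (A : set 'rV[R]_n)
    (f : 'rV[R]_n -> R) : Prop :=
  {within A, continuous f} /\
  if k is k'.+1 then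
    forall i : 'I_n, (forall x, A x -> derivable f x (delta_mx ord0 i)) /\
                     class_C k' A (partial i f)
  else True.

(* The elements of C_c^oo(A) are taken extended by 0 outside A. *)
Definition test_function (R : realType) n (A : set 'rV[R]_n)
    (f : 'rV[R]_n -> R) : Prop :=
  [/\ forall k, class_C k A f,
      compact (closure [set x | f x != 0]) &
      closure [set x | f x != 0] `<=` A].

(* Positive classical supersolution of - Delta u + b |grad u| = c u in A. *)
Definition positive_supersolution (R : realType) n (A : set 'rV[R]_n)
    (b c u : 'rV[R]_n -> R) : Prop :=
  [/\ class_C 2 A u,
      forall x, A x -> 0 < u x &
      forall x, A x ->
        c x * u x <= - laplacian u x + b x * enorm (gradient u x)].

(* Main.v *)
(** With w = grad u / u, dividing the differential inequality by u gives
    c <= - div w - |w|^2 + b |w|.  Multiplying by phi^2 and applying Young's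
    inequality with weights 1/(1+l) and l/(1+l), chosen so that the terms in
    phi^2 |w|^2 cancel, yields pointwise, for every l > 0,
      c phi^2 + div (phi^2 w) <= (1+l) |grad phi|^2 + (1+1/l) b^2/4 phi^2.
    The divergence of the compactly supported C^1 field phi^2 w integrates to 0
    (Fubini and the fundamental theorem of calculus), and optimising over l
    turns the right-hand side into the square of the sum of the two roots. *)
Require Import Defs.
From mathcomp Require Import all_boot all_order all_algebra.
From mathcomp Require Import all_classical all_reals all_analysis.
From mathcomp Require Import measurable_realfun ring lra.
Import Order.TTheory GRing.Theory Num.Theory.
Import numFieldNormedType.Exports.
Local Open Scope classical_set_scope.
Local Open Scope ring_scope.

(** * Measurability and integrability of continuous functions on row vectors *)

Lemma measurable_rV_box d (T : measurableType d) n (A : 'I_n -> set T) :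
  (forall i, measurable (A i)) ->
  measurable [set x : 'rV[T]_n | forall i, A i (x ord0 i)].
Proof.
move=> mA; rewrite (_ : mkset _ = \bigcap_(i in [set: 'I_n])
    (fun x : 'rV[T]_n => x ord0 i) @^-1` A i); last first.
  by apply/seteqP; split => [x Ax i _|x Ax i]; exact: Ax.
apply: fin_bigcap_measurable => [|i _]; first exact: finite_finset.
by rewrite -[X in measurable X]setTI; exact: measurable_rV_coord.
Qed.

(** The sigma-algebra is generated by the coordinates, so boxes are measurable; [A] is the union of
    the countably many open boxes with rational corners that it contains. Balls of the maximum norm
    are cubes, hence a rational box around each point fits inside a ball contained in [A]. *)
Lemma open_measurable_rV (R : realType) n (A : set 'rV[R]_n) :
  open A -> measurable A.
Proof.
move=> oA.
pose B (p : 'rV[rat]_n * 'rV[rat]_n) :=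
  [set x : 'rV[R]_n | forall i, x ord0 i \in `]ratr (p.1 ord0 i), ratr (p.2 ord0 i)[].
have mB p : measurable (B p).
  apply: (@measurable_rV_box _ (measurableTypeR R) n
    (fun i => `]ratr (p.1 ord0 i), ratr (p.2 ord0 i)[%classic)) => i.
  exact: measurable_itv.
rewrite (_ : A = \bigcup_p (if `[< B p `<=` A >] then B p else set0)).
  apply: countable_bigcupT_measurable => [|p]; first exact: countableP.
  by case: ifPn.
apply/seteqP; split => [x Ax|x [p _]]; last by case: ifPn => [/asboolP|_ //]; exact.
have /nbhs_ballP[e /= e0 xeA] : nbhs x A by exact: open_nbhs_nbhs.
have hl i : exists q : rat, ratr q \in `]x ord0 i - e, x ord0 i[.
  by apply: rat_in_itvoo; rewrite ltrBlDr ltrDl.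
have hr i : exists q : rat, ratr q \in `]x ord0 i, x ord0 i + e[.
  by apply: rat_in_itvoo; rewrite ltrDl.
have [l lP] := choice hl; have [r rP] := choice hr.
exists (\row_i l i, \row_i r i) => //; rewrite ifT.
  move=> i /=; rewrite !mxE in_itv /=.
  by move: (lP i) (rP i); rewrite !in_itv/= => /andP[_ ->] /andP[->].
apply/asboolP => y yB; apply: xeA; split => // j i; rewrite (ord1 j).
move: (yB i) (lP i) (rP i); rewrite !mxE !in_itv/=.
move=> /andP[ly yr] /andP[hl1 hl2] /andP[hr1 hr2].
rewrite /ball/= distrC ltr_distl; apply/andP; split.
  exact: lt_trans ly.
exact: lt_trans yr _.
Qed.

Lemma continuous_measurable_rV (R : realType) n (f : 'rV[R]_n -> R) :
  continuous f -> measurable_fun setT f.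
Proof.
move=> /continuousP cf.
apply: (measurability _ (RGenOpens.measurableE R)).
move=> _ [_ [a [b ->]] <-].
by rewrite setTI; apply: open_measurable_rV; exact/cf/interval_open.
Qed.

(** The cube of half-side [M] is compact, so [f] is bounded on it, and its measure is a finite
    product of finite edge lengths; outside the cube [f] is zero. *)
Lemma integrable_box (R : realType) n (f : 'rV[R]_n -> R) (M : R) :
  continuous f -> (forall (x : 'rV[R]_n) i, M < `|x ord0 i| -> f x = 0) ->
  lebesgue_rV.-integrable setT (EFin \o f).
Proof.
move=> cf f0.
pose K := [set x : 'rV[R]_n | forall i, `[- M, M]%classic (x ord0 i)].
have cK : compact K by apply: (@rV_compact R n (fun=> _)) => i; exact: segment_compact.
have mK : measurable K.
  apply: (@measurable_rV_box _ (measurableTypeR R) n (fun=> `[- M, M]%classic)).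
  by move=> i; exact: measurable_itv.
have KE : f = f \_ K.
  apply/funext => x; rewrite patchE; case: ifPn => // /negP xK.
  have [i xi] : exists i, M < `|x ord0 i|.
    apply: contra_notP xK => /forallNP xM; rewrite inE => i /=.
    by rewrite in_itv/= -ler_norml leNgt; exact/negP.
  exact: f0 xi.
rewrite KE -restrict_EFin -integrable_mkcond//.
apply: measurable_bounded_integrable => //.
- have muK : lebesgue_rV K = _ :=
    @lebesgue_rV_box R n (fun=> `[- M, M]%classic) (fun=> measurable_itv _).
  rewrite [X in (X < _)%E]muK.
  elim/big_rec : _ => [|i y _ yoo]; first by rewrite ltry.
  apply: lte_mul_pinfty => //.
  rewrite ge0_fin_numE// lebesgue_measure_itv/= lte_fin.
  by case: ifP => // _; rewrite -EFinB ltry.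
- exact: measurable_funS (continuous_measurable_rV _ _ _ cf).
- have /compact_bounded[C [_ fC]] : compact (f @` K).
    by apply: continuous_compact => //; exact: continuous_subspaceT.
  by exists C; split; rewrite ?num_real// => r Cr x Kx; apply: (fC r Cr); exists x.
Qed.

(** * Slices along the first coordinate and derivatives along slices *)

Lemma rV_cons0 (T : Type) n (p : T * 'rV[T]_n) : rV_cons p ord0 ord0 = p.1.
Proof.
rewrite (_ : ord0 = lshift n (ord0 : 'I_1)); last exact/val_inj.
by apply: etrans (row_mxEl _ _ _ _) _; rewrite mxE.
Qed.

Lemma rV_consS (T : Type) n (p : T * 'rV[T]_n) i :
  rV_cons p ord0 (lift ord0 i) = p.2 ord0 i.
Proof.
rewrite (_ : lift _ _ = rshift 1 i); last exact/val_inj.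
exact: (row_mxEr (const_mx p.1)).
Qed.

Lemma ball_rV_cons (R : realType) n (p q : R * 'rV[R]_n) e :
  ball p e q -> ball (rV_cons p : 'rV[R]_n.+1) e (rV_cons q).
Proof.
move=> [q1 [e0 q2]]; split => // i j; rewrite (ord1 i).
by have [k|] := unliftP ord0 j => ->; rewrite ?rV_consS ?rV_cons0.
Qed.

Lemma rV_cons_continuousl (R : realType) n (y : 'rV[R]_n) :
  continuous (fun t : R => rV_cons (t, y)).
Proof.
move=> t A /nbhs_ballP[e e0 eA]; apply/nbhs_ballP; exists e => // z xz.
by apply: eA; apply: ball_rV_cons; split; last exact: ballxx.
Qed.

Lemma rV_cons_continuousr (R : realType) n (t : R) :
  continuous (fun y : 'rV[R]_n => rV_cons (t, y)).
Proof.
move=> y A /nbhs_ballP[e e0 eA]; apply/nbhs_ballP; exists e => // z xz.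
by apply: eA; apply: ball_rV_cons; split; first exact: ballxx.
Qed.

Section affine_chain.
Context {R : realType} {V V' W : normedModType R}.
Variables (f : V' -> W) (L : V -> V') (x v : V) (w : V').
Hypothesis Lw : forall h : R, L (h *: v + x) = h *: w + L x.

(** [f \o L] along [v] and [f] along [w] have the same difference quotients. This transfers
    directional derivatives to slices, [L] being the insertion of the first coordinate or of the
    remaining ones. *)
Let growth : (fun h : R => h^-1 *: (((f \o L) \o shift x) (h *: v) - (f \o L) x)) =
  (fun h : R => h^-1 *: ((f \o shift (L x)) (h *: w) - f (L x))).
Proof. by apply/funext => h /=; rewrite Lw. Qed.

Lemma derivable_affine : derivable f (L x) w -> derivable (f \o L) x v.
Proof. by rewrite /derivable growth. Qed.

Lemma derive_affine : 'D_v (f \o L) x = 'D_w f (L x).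
Proof. by rewrite /derive growth. Qed.

End affine_chain.

Lemma is_derive_near0 {R : realType} {V W : normedModType R} (f : V -> W) (x v : V) :
  (\near x, f x = 0) -> is_derive x v f 0.
Proof.
by move=> f0; apply: (@near_eq_is_derive _ _ _ (cst 0)); near do apply/esym.
Unshelve. all: by end_near. Qed.

(** * Integrals of derivatives of functions with bounded support *)

Lemma integral_derive1_eq0 (R : realType) (g : R -> R) (M : R) :
  (forall t, derivable g t 1) -> continuous (fun t => 'D_1 g t) ->
  (forall t, M < `|t| -> g t = 0) ->
  (\int[lebesgue_measure]_t ('D_1 g t)%:E = 0)%E.
Proof.
move=> dg cg g0.
(* [a] exceeds [M] and is positive whatever the sign of [M]: [[- a, a]] is nondegenerate, [g]
   vanishes at both endpoints, and its derivative vanishes outside. *)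
pose a := `|M| + 1.
have a0 : 0 < a by rewrite ltr_wpDl.
have Ma : M < a by rewrite (le_lt_trans (ler_norm _))// ltrDl.
have dg0 t : M < `|t| -> 'D_1 g t = 0.
  move=> Mt; have dgt : is_derive t 1 g 0.
    apply: is_derive_near0; near=> s; apply: g0; near: s.
    exact: (cvgr_gt `|t| (@norm_continuous _ _ t)).
  exact: derive_val.
rewrite (_ : (fun t => _) = ((fun t => ('D_1 g t)%:E) \_ `[- a, a])); last first.
  apply/funext => t; rewrite patchE; case: ifPn => //; rewrite mem_setE in_itv/= => ta.
  rewrite dg0// (lt_trans Ma)// ltNge; apply: contra ta.
  by rewrite ler_norml.
rewrite -integral_mkcond (@continuous_FTC2 _ _ g).
- by rewrite !g0 ?subee// ?normrN gtr0_norm.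
- by rewrite gtrN.
- by apply: continuous_subspaceT.
- have cg' : continuous g.
    by move=> t; apply: differentiable_continuous; apply/derivable1_diffP.
  split=> [t _ //||]; [exact: cvg_at_right_filter (cg' _)|exact: cvg_at_left_filter (cg' _)].
- by move=> t _; rewrite derive1E.
Unshelve. all: by end_near. Qed.

Section lebesgue_rV_iterated.
Context {R : realType} {n : nat} (f : 'rV[R]_n.+1 -> R).
Hypothesis intf : lebesgue_rV.-integrable setT (EFin \o f).
Local Open Scope ereal_scope.

Let mcons : measurable_fun [set: measurableTypeR R * 'rV[R]_n] (@rV_cons R n).
Proof. exact: (@measurable_rV_cons _ (measurableTypeR R)). Qed.

Let g : measurableTypeR R * 'rV[R]_n -> \bar R := (EFin \o f) \o @rV_cons R n.

(** Fubini requires integrability on the product. As [lebesgue_rV] in dimension [n.+1] is the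
    pushforward of the product measure under [rV_cons], the change of variables for the nonnegative
    function [|f|] transfers the finiteness of the integral. *)
Let intg : (@lebesgue_measure R \x @lebesgue_rV R n).-integrable setT g.
Proof.
have /integrableP[mf foo] := intf.
apply/integrableP; split; first exact: (measurableT_comp mf mcons).
have := @ge0_integral_pushforward _ _ _ _ R _ mcons
  (@lebesgue_measure R \x @lebesgue_rV R n) setT (abse \o (EFin \o f))
  measurableT (measurableT_comp (@abse_measurable R setT) mf) (fun y _ => abse_ge0 _).
rewrite preimage_setT => E.
by apply: le_lt_trans foo; rewrite le_eqVlt; apply/orP; left; apply/eqP/esym.
Qed.

Let integral_cons :
  \int[lebesgue_rV]_x (f x)%:E = \int[lebesgue_measure \x lebesgue_rV]_p g p.
Proof.
have /integrableP[mf _] := intf.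
have := @integral_pushforward _ _ _ _ R _ mcons
  (@lebesgue_measure R \x @lebesgue_rV R n) setT (EFin \o f) mf.
by rewrite preimage_setT => /(_ intg measurableT).
Qed.

Lemma integral_rV_cons12 :
  \int[lebesgue_rV]_x (f x)%:E =
  \int[lebesgue_measure]_t \int[lebesgue_rV]_y (f (rV_cons (t, y)))%:E.
Proof. by rewrite integral_cons -integral12_prod_meas1. Qed.

Lemma integral_rV_cons21 :
  \int[lebesgue_rV]_x (f x)%:E =
  \int[lebesgue_rV]_y \int[lebesgue_measure]_t (f (rV_cons (t, y)))%:E.
Proof. by rewrite integral_cons -integral21_prod_meas1. Qed.

End lebesgue_rV_iterated.

(** Induction on the dimension. If [i] is not the first coordinate, the inner integral is taken over
    the remaining coordinates and vanishes by the induction hypothesis; if it is the first one, the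
    inner integral is one-dimensional and vanishes by the fundamental theorem of calculus. *)
Lemma integral_partial_eq0 (R : realType) n (i : 'I_n) (f : 'rV[R]_n -> R) (M : R) :
  (forall x, derivable f x (delta_mx ord0 i)) -> continuous (partial i f) ->
  (forall (x : 'rV[R]_n) j, M < `|x ord0 j| -> f x = 0) ->
  (\int[lebesgue_rV]_x (partial i f x)%:E = 0)%E.
Proof.
elim: n i f => [[]//|n IHn] i f df cf f0.
(* The derivative vanishes outside the same cube as [f]: the condition [M < |x_j|] is open, so [f]
   is zero near such an [x]. *)
have intf : lebesgue_rV.-integrable setT (EFin \o partial i f).
  apply: (@integrable_box _ _ _ M) => // x j Mx.
  have : is_derive x (delta_mx ord0 i) f 0.
    apply: is_derive_near0; near=> y; apply: (f0 y j); near: y.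
    apply: (@cvgr_gt _ _ _ _ (fun y : 'rV[R]_n.+1 => `|y ord0 j|)) Mx.
    by apply: cvg_norm; exact: coord_continuous.
  by move=> ?; exact: derive_val.
case: (unliftP ord0 i) intf df cf => [k|] -> intf df cf.
- rewrite integral_rV_cons12// integral0_eq// => t _.
  pose L (y : 'rV[R]_n) := rV_cons (t, y).
  have Ldelta y (h : R) : L (h *: delta_mx ord0 k + y) =
      h *: delta_mx ord0 (lift ord0 k) + L y.
    apply/rowP => j; rewrite [RHS]mxE [X in _ = X + _]mxE [X in _ = _ * X + _]mxE.
    have [l|] := unliftP ord0 j => ->; rewrite ?rV_consS ?rV_cons0 /=.
      by rewrite !mxE (inj_eq lift_inj).
    by rewrite ?eq_liftF mulr0 add0r.
  have LE y := derive_affine f L y _ _ (Ldelta y).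
  under eq_integral do rewrite -[partial _ f _]LE.
  apply: IHn => [y||y j Mx].
  + exact: derivable_affine (Ldelta y) (df _).
  + rewrite (_ : partial _ _ = partial (lift ord0 k) f \o L).
      move=> y; apply: continuous_comp; last exact: cf.
      exact: rV_cons_continuousr.
    by apply/funext.
  + by apply: (f0 _ (lift ord0 j)); rewrite rV_consS.
- rewrite integral_rV_cons21// integral0_eq// => y _.
  pose L (t : R) := rV_cons (t, y).
  have Ldelta (t h : R) : L (h *: 1 + t) = h *: delta_mx ord0 ord0 + L t.
    apply/rowP => j; rewrite [RHS]mxE [X in _ = X + _]mxE [X in _ = _ * X + _]mxE.
    have [l|] := unliftP ord0 j => ->; rewrite ?rV_consS ?rV_cons0 //=.
    by rewrite ?lift_eqF mulr0 add0r.
  have LE t := derive_affine f L t _ _ (Ldelta t).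
  under eq_integral do rewrite -[partial _ f _]LE.
  apply: (@integral_derive1_eq0 _ _ M) => [t||t Mt].
  + exact: derivable_affine (Ldelta t) (df _).
  + rewrite (_ : (fun t => _) = partial ord0 f \o L).
      move=> t; apply: continuous_comp; last exact: cf.
      exact: rV_cons_continuousl.
    by apply/funext.
  + by apply: (f0 _ ord0); rewrite rV_cons0.
Unshelve. all: by end_near. Qed.

(** * Continuity on open sets and extension by zero *)

Section class_C_theory.
Context {R : realType} {n : nat} {A : set 'rV[R]_n}.
Hypothesis oA : open A.

Lemma within_open_continuous (f : 'rV[R]_n -> R) :
  {within A, continuous f} -> forall x, A x -> {for x, continuous f}.
Proof. by rewrite continuous_open_subspace// => cf x Ax; apply: cf; rewrite inE. Qed.

Lemma class_C_continuous k (f : 'rV[R]_n -> R) :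
  class_C k A f -> forall x, A x -> {for x, continuous f}.
Proof. by case: k => [|k] [/within_open_continuous]. Qed.

End class_C_theory.

Lemma near0_off_closed (R : realType) n (K : set 'rV[R]_n) (f : 'rV[R]_n -> R) :
  closed K -> (forall x, ~ K x -> f x = 0) ->
  forall x, ~ K x -> \forall y \near x, f y = 0.
Proof.
move=> cK f0 x Kx; have : nbhs x (~` K).
  by apply: open_nbhs_nbhs; split => //; exact: closed_openC.
by apply: filterS => y /f0.
Qed.

(** A point of [K] lies in [A], where [f] is continuous; a point off [K] has a neighbourhood on
    which [f] is zero, because [K] is closed. *)
Lemma cutoff_continuous (R : realType) n (A K : set 'rV[R]_n) (f : 'rV[R]_n -> R) :
  closed K -> K `<=` A -> (forall x, A x -> {for x, continuous f}) ->
  (forall x, ~ K x -> f x = 0) -> continuous f.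
Proof.
move=> cK KA cf f0 x; have [/KA/cf//|Kx] := pselect (K x).
have f0x : {near x, cst 0 =1 f}.
  by apply: filterS (near0_off_closed _ _ _ _ cK f0 _ Kx) => y ->.
rewrite /prop_for /continuous_at f0//.
apply: cvg_trans (near_eq_cvg f0x) _; exact: cvg_cst.
Qed.

Lemma compact_box (R : realType) n (K : set 'rV[R]_n) : compact K ->
  exists M : R, forall (x : 'rV[R]_n) i, M < `|x ord0 i| -> ~ K x.
Proof.
(* Boundedness gives a norm bound only by constants strictly above [M], hence [M + 1]. *)
move=> /compact_bounded[M [_ KM]]; exists (M + 1) => x i Mx Kx.
suff : `|x ord0 i| <= M + 1 by rewrite leNgt Mx.
have M1 : M < M + 1 by rewrite ltrDl.
apply: le_trans (KM _ M1 _ Kx).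
rewrite [leRHS]/Num.norm /= mx_normrE.
exact: (le_bigmax _ (fun j => `|x j.1 j.2|) (ord0, i)).
Qed.

(** * Optimisation over the parameter and the pointwise Young inequality *)

Lemma le_sqr_sum_sqrt (R : realType) (A B C : R) : 0 <= A -> 0 <= B ->
  (forall l, 0 < l -> C <= (1 + l) * A + (1 + l^-1) * B) ->
  C <= (Num.sqrt A + Num.sqrt B) ^+ 2.
Proof.
move=> A0 B0 CAB; set a := Num.sqrt A; set b := Num.sqrt B.
have a0 : 0 <= a := sqrtr_ge0 _; have b0 : 0 <= b := sqrtr_ge0 _.
have AE : A = a ^+ 2 by rewrite sqr_sqrtr.
have BE : B = b ^+ 2 by rewrite sqr_sqrtr.
have ab0 : 0 < 1 + a + b by lra.
apply/ler_addgt0Pr => e e0.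
(* The optimal l is b / a; adding d > 0 keeps it defined when a or b vanishes. *)
pose d := e / (1 + a + b).
have d0 : 0 < d by rewrite divr_gt0.
have dab : d * (a + b) <= e.
  by rewrite /d mulrAC ler_pdivrMr// ler_pM2l//; lra.
have ad : 0 < a + d by lra.
have bd : 0 < b + d by lra.
apply: le_trans (CAB ((b + d) / (a + d)) _) _; first by rewrite divr_gt0.
rewrite invf_div AE BE.
(* Since [a <= a + d] and [b <= b + d], the two mixed terms cost at most [(b + d) * a] and
   [(a + d) * b]. The total is then at most [(a + b) ^+ 2 + d * (a + b)], and [d] was scaled so that
   the excess is at most [e]. *)
have h1 : (b + d) / (a + d) * a ^+ 2 <= (b + d) * a.
  rewrite mulrAC ler_pdivrMr// expr2 mulrA ler_wpM2l//; last lra.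
  by rewrite mulr_ge0// ltW.
have h2 : (a + d) / (b + d) * b ^+ 2 <= (a + d) * b.
  rewrite mulrAC ler_pdivrMr// expr2 mulrA ler_wpM2l//; last lra.
  by rewrite mulr_ge0// ltW.
rewrite !mulrDl !mul1r; nra.
Qed.

(** Here [p] stands for grad phi, [q] for w = grad u / u, [f] for phi, [s] for |w| and [L] for Delta
    u / u. Thus [L - s ^+ 2] is div w, and the bracket on the left is div (phi^2 w). *)
Lemma sum_young (R : realType) n (p q : 'I_n -> R) (f l b s c L : R) :
  0 < l -> c <= - L + b * s -> s ^+ 2 = \sum_i q i ^+ 2 ->
  c * f ^+ 2 + (2 * f * (\sum_i p i * q i) + f ^+ 2 * (L - s ^+ 2)) <=
  (1 + l) * (\sum_i p i ^+ 2) + (1 + l^-1) * (b ^+ 2 / 4 * f ^+ 2).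
Proof.
move=> l0 cL sq.
have l1 : 0 < 1 + l by lra.
have h1 : 2 * f * (\sum_i p i * q i) <=
    (1 + l) * (\sum_i p i ^+ 2) + f ^+ 2 * s ^+ 2 / (1 + l).
  rewrite sq !mulr_sumr mulr_suml -big_split/=; apply: ler_sum => i _.
  rewrite -subr_ge0.
  suff -> : (1 + l) * p i ^+ 2 + f ^+ 2 * q i ^+ 2 / (1 + l) - 2 * f * (p i * q i)
    = (1 + l) * (p i - f * q i / (1 + l)) ^+ 2 by rewrite mulr_ge0 ?sqr_ge0 ?ltW.
  by field; rewrite gt_eqF.
(* As in [h1], the difference of the two sides is a nonnegative multiple of a square, whatever the
   sign of [b]. *)
have h2 : f ^+ 2 * (b * s) <=
    (1 + l^-1) * (b ^+ 2 / 4 * f ^+ 2) + f ^+ 2 * s ^+ 2 * (l / (1 + l)).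
  rewrite -subr_ge0.
  suff -> : (1 + l^-1) * (b ^+ 2 / 4 * f ^+ 2) + f ^+ 2 * s ^+ 2 * (l / (1 + l)) -
    f ^+ 2 * (b * s) = (1 + l) / l * (f * (b / 2 - l / (1 + l) * s)) ^+ 2.
    by rewrite mulr_ge0 ?sqr_ge0// divr_ge0 ?ltW.
  by field; rewrite !gt_eqF.
(* After adding this bound the terms in [L] cancel; the two Young weights sum to 1, so their
   contributions absorb exactly the remaining [- f ^+ 2 * s ^+ 2]. *)
have h3 : c * f ^+ 2 <= (- L + b * s) * f ^+ 2 by rewrite ler_wpM2r// sqr_ge0.
have h4 : f ^+ 2 * s ^+ 2 / (1 + l) + f ^+ 2 * s ^+ 2 * (l / (1 + l)) = f ^+ 2 * s ^+ 2.
  by field; rewrite gt_eqF.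
lra.
Qed.

(** Product and quotient rules for a component of phi^2 w, with [g] a partial derivative of [u]. The
    value is grouped by the quotients by [u x], the form in which the pointwise inequality uses
    it. *)
Lemma is_derive_sqr_mul_div (R : realType) (V : normedModType R) (f g u : V -> R)
    (x v : V) (df dg du : R) : u x != 0 ->
  is_derive x v f df -> is_derive x v g dg -> is_derive x v u du ->
  is_derive x v (fun y => f y ^+ 2 * (g y / u y))
    (2 * f x * (df * (g x / u x)) +
     f x ^+ 2 * (dg / u x - g x / u x * (du / u x))).
Proof.
move=> ux0 hf hg hu.
have hV : is_derive x v (fun y => (u y)^-1) (- (u x) ^- 2 *: du).
  by have [du' <-] := hu; split; [exact: derivableV|rewrite deriveV].
have hM := is_deriveM (is_deriveM hf hf) (is_deriveM hg hV).
rewrite (_ : (fun y => _) = (f * f) * (g * (fun y => (u y)^-1))); last first.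
  by apply/funext => y; rewrite expr2.
apply: (is_derive_eq hM).
rewrite /GRing.scale /= -![(_ * _ : V -> R) x]/(_ x * _ x) /=.
by field.
Qed.

Lemma continuous_sum (R : realType) (T : topologicalType) (I : Type) (r : seq I)
    (f : I -> T -> R) (x : T) : (forall i, {for x, continuous (f i)}) ->
  {for x, continuous (fun y => \sum_(i <- r) f i y)}.
Proof. by move=> cf; apply: cvg_big => [|i _]; [exact: add_continuous|exact: cf]. Qed.

(** * The field phi^2 grad u / u and the integrated inequality with parameter *)

Section supersolution.
Context {R : realType} {n : nat} {Omega : set 'rV[R]_n} {b c u phi : 'rV[R]_n -> R}.
Hypotheses (oOmega : open Omega) (hb : {within Omega, continuous b})
  (hc : {within Omega, continuous c}) (hu : positive_supersolution Omega b c u)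
  (hphi : test_function Omega phi).

Let K := closure [set x | phi x != 0].

Let cK : closed K. Proof. exact: closed_closure. Qed.
Let KOmega : K `<=` Omega. Proof. by have [] := hphi. Qed.

Let phi0 x : ~ K x -> phi x = 0.
Proof. by move=> Kx; apply: contra_notP Kx => /eqP px; exact: subset_closure. Qed.

Let near_phi0 x : ~ K x -> \forall y \near x, phi y = 0.
Proof. exact: near0_off_closed. Qed.

(** Differentiability holds on the whole space: on the support it comes from smoothness in [Omega],
    and elsewhere [phi] vanishes locally. *)
Let dphi x (i : 'I_n) : is_derive x (delta_mx ord0 i) phi (partial i phi x).
Proof.
have [/KOmega Ox|Kx] := pselect (K x).
  have [/(_ 1%N)[_ /(_ i)[dp _]] _ _] := hphi.
  exact/derivableP/dp.
have [dp _] := is_derive_near0 phi x (delta_mx ord0 i) (near_phi0 x Kx).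
exact/derivableP/dp.
Qed.

Let partial_phi0 x i : ~ K x -> partial i phi x = 0.
Proof.
move=> Kx.
by have [_ d0] := is_derive_near0 phi x (delta_mx ord0 i) (near_phi0 x Kx).
Qed.

Let phi_continuous x : Omega x -> {for x, continuous phi}.
Proof. by have [/(_ 0%N)] := hphi => /(class_C_continuous oOmega) + _ _; exact. Qed.

Let phi2_continuous x : Omega x -> {for x, continuous (fun y => phi y ^+ 2)}.
Proof.
move=> Ox; apply: (@continuous_comp _ _ _ phi (fun r => r ^+ 2)).
  exact: phi_continuous.
exact: exprn_continuous.
Qed.

Let partial_phi_continuous i x : Omega x -> {for x, continuous (partial i phi)}.
Proof.
have [/(_ 1%N)[_ /(_ i)[_ cp]] _ _] := hphi.
exact: (class_C_continuous oOmega 0%N _ cp).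
Qed.

Let u_gt0 x : Omega x -> 0 < u x. Proof. by have [_ + _] := hu; exact. Qed.

Let u_continuous x : Omega x -> {for x, continuous u}.
Proof. by have [/(class_C_continuous oOmega) + _ _] := hu; exact. Qed.

Let du x i : Omega x -> is_derive x (delta_mx ord0 i) u (partial i u x).
Proof. by move=> Ox; have [[_ /(_ i)[d _]] _ _] := hu; exact/derivableP/d. Qed.

Let ddu x i : Omega x ->
  is_derive x (delta_mx ord0 i) (partial i u) (partial i (partial i u) x).
Proof.
by move=> Ox; have [[_ /(_ i)[_ [_ /(_ i)[d _]]]] _ _] := hu; exact/derivableP/d.
Qed.

Let partial_u_continuous i x : Omega x -> {for x, continuous (partial i u)}.
Proof.
have [[_ /(_ i)[_ h]] _ _] := hu.
exact: (class_C_continuous oOmega 1%N _ h).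
Qed.

Let partial2_u_continuous i x :
  Omega x -> {for x, continuous (partial i (partial i u))}.
Proof.
have [[_ /(_ i)[_ [_ /(_ i)[_ h]]]] _ _] := hu.
exact: (class_C_continuous oOmega 0%N _ h).
Qed.

(** The i-th summand of div (phi^2 w). Outside [Omega], where [u] is arbitrary and may be zero, the
    factors [phi x] make the whole expression zero. *)
Let div_term i x :=
  2 * phi x * (partial i phi x * (partial i u x / u x)) +
  phi x ^+ 2 * (partial i (partial i u) x / u x -
                partial i u x / u x * (partial i u x / u x)).

Let log_field i x := phi x ^+ 2 * (partial i u x / u x).

Let dlog_field i x :
  is_derive x (delta_mx ord0 i) (log_field i) (div_term i x).
Proof.
have [/KOmega Ox|Kx] := pselect (K x).
  have ux0 : u x != 0 by rewrite gt_eqF ?u_gt0.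
  by apply: is_derive_sqr_mul_div; [|exact: dphi|exact: ddu|exact: du].
rewrite /div_term phi0// mulr0 expr0n/= !mul0r addr0.
apply: is_derive_near0; apply: filterS (near_phi0 x Kx) => y py.
by rewrite /log_field py expr0n/= mul0r.
Qed.

Let partial_log_field i : partial i (log_field i) = div_term i.
Proof. by apply/funext => x; have [] := dlog_field i x. Qed.

Let div_term0 i x : ~ K x -> div_term i x = 0.
Proof. by move=> /phi0 p0; rewrite /div_term p0 mulr0 expr0n/= !mul0r addr0. Qed.

(** In [Omega] all the factors are continuous, the quotients because [u] is positive there; off the
    support the expression is zero, so the cutoff argument gives global continuity. *)
Let div_term_continuous i : continuous (div_term i).
Proof.
apply: (cutoff_continuous _ _ _ _ _ cK KOmega); last exact: div_term0.
move=> x Ox.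
have cp := phi_continuous _ Ox; have cpp := partial_phi_continuous i _ Ox.
have cdu : {for x, continuous (fun y => partial i u y / u y)}.
  apply: continuousM; first exact: partial_u_continuous.
  by apply: continuousV; [rewrite gt_eqF ?u_gt0|exact: u_continuous].
have cddu : {for x, continuous (fun y => partial i (partial i u) y / u y)}.
  apply: continuousM; first exact: partial2_u_continuous.
  by apply: continuousV; [rewrite gt_eqF ?u_gt0|exact: u_continuous].
apply: continuousD.
  apply: continuousM; first by apply: continuousM => //; exact: cst_continuous.
  exact: continuousM.
apply: continuousM; first exact: phi2_continuous.
by apply: continuousB => //; exact: continuousM.
Qed.

Let supp_box : exists M : R, forall (x : 'rV[R]_n) i, M < `|x ord0 i| -> ~ K x.
Proof. by have [_ /compact_box[M KM] _] := hphi; exists M. Qed.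

Let integrable_supp (f : 'rV[R]_n -> R) :
  (forall x, Omega x -> {for x, continuous f}) -> (forall x, ~ K x -> f x = 0) ->
  lebesgue_rV.-integrable setT (EFin \o f).
Proof.
move=> cf f0; have [M KM] := supp_box.
apply: (integrable_box _ _ _ M) => [|x i /KM /f0//].
exact: (cutoff_continuous _ _ _ _ _ cK KOmega).
Qed.

Let integral_div_term i : (\int[lebesgue_rV]_x (div_term i x)%:E = 0)%E.
Proof.
have [M KM] := supp_box.
rewrite -partial_log_field; apply: (integral_partial_eq0 _ _ _ _ M) => [x||x j Mx].
- by have [] := dlog_field i x.
- by rewrite partial_log_field.
- by rewrite /log_field phi0 ?expr0n ?mul0r//; exact: KM Mx.
Qed.

Let mOmega : measurable Omega. Proof. exact: open_measurable_rV. Qed.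

Let integrable_Omega (f : 'rV[R]_n -> R) :
  (forall x, Omega x -> {for x, continuous f}) -> (forall x, ~ K x -> f x = 0) ->
  lebesgue_rV.-integrable Omega (EFin \o f).
Proof.
by move=> cf f0; apply: (integrableS measurableT mOmega) => //; exact: integrable_supp.
Qed.

Let D x := \sum_i div_term i x.

Let integrable_D : lebesgue_rV.-integrable Omega (EFin \o D).
Proof.
apply: integrable_Omega => [x Ox|x Kx].
  apply: continuous_sum => i; exact: div_term_continuous.
by rewrite /D big1// => i _; exact: div_term0.
Qed.

Let integral_D : \int[lebesgue_rV]_(x in Omega) D x = 0.
Proof.
(* [D] vanishes off the support of [phi], which lies in [Omega], so the integral may be taken over
   the whole space. *)
rewrite Rintegral_mkcond (_ : _ \_ _ = D); last first.
  apply/funext => x; rewrite patchE; case: ifPn => // /negP; rewrite inE => Ox.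
  by rewrite /D big1// => i _; apply: div_term0 => /KOmega.
rewrite /Rintegral; under eq_integral do rewrite -sumEFin.
rewrite integral_sum//=; last first.
  by move=> i; apply: integrable_supp => x => [_|]; [exact: div_term_continuous|exact: div_term0].
by rewrite big1// => i _; exact: integral_div_term.
Qed.

Lemma enorm_gradient (f : 'rV[R]_n -> R) x :
  enorm (gradient f x) ^+ 2 = \sum_i partial i f x ^+ 2.
Proof.
rewrite sqr_sqrtr; last by apply: sumr_ge0 => i _; exact: sqr_ge0.
by apply: eq_bigr => i _; rewrite mxE.
Qed.

Lemma integrable_gradient_test :
  lebesgue_rV.-integrable Omega (EFin \o fun x => enorm (gradient phi x) ^+ 2).
Proof.
rewrite (_ : (fun x => _) = fun x => \sum_i partial i phi x ^+ 2); last first.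
  by apply/funext => x; rewrite enorm_gradient.
apply: integrable_Omega => [x Ox|x Kx].
  apply: continuous_sum => i.
  apply: (@continuous_comp _ _ _ (partial i phi) (fun r => r ^+ 2)).
    exact: partial_phi_continuous.
  exact: exprn_continuous.
by rewrite big1// => i _; rewrite partial_phi0// expr0n.
Qed.

Lemma integrable_mul_test (g : 'rV[R]_n -> R) : {within Omega, continuous g} ->
  lebesgue_rV.-integrable Omega (EFin \o fun x => g x * phi x ^+ 2).
Proof.
move=> cg; apply: integrable_Omega => [x Ox|x /phi0 ->]; last by rewrite expr0n mulr0.
apply: continuousM; last exact: phi2_continuous.
exact: (within_open_continuous oOmega).
Qed.

Lemma within_continuous_sqr_div4 : {within Omega, continuous (fun x => b x ^+ 2 / 4)}.
Proof.
suff cb x : Omega x -> {for x, continuous (fun y => b y ^+ 2 / 4)}.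
  by rewrite continuous_open_subspace// => x; rewrite inE => /cb.
move=> Ox; apply: continuousM; last exact: cst_continuous.
apply: (@continuous_comp _ _ _ b (fun r => r ^+ 2)).
  exact: (within_open_continuous oOmega).
exact: exprn_continuous.
Qed.

(** Dividing the differential inequality by [u x > 0] gives the hypothesis of [sum_young]; the
    summands of [D] regroup into its bracket. *)
Let log_field_le l x : 0 < l -> Omega x ->
  c x * phi x ^+ 2 + D x <= (1 + l) * enorm (gradient phi x) ^+ 2 +
                            (1 + l^-1) * (b x ^+ 2 / 4 * phi x ^+ 2).
Proof.
move=> l0 Ox; have ux := u_gt0 _ Ox.
pose q i := partial i u x / u x.
pose s := enorm (gradient u x) / u x.
have sE : s ^+ 2 = \sum_i q i ^+ 2.
  rewrite /s expr_div_n enorm_gradient mulr_suml.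
  by apply: eq_bigr => i _; rewrite /q expr_div_n.
have := sum_young _ _ (fun i => partial i phi x) q (phi x) l (b x) s (c x)
  (laplacian u x / u x) l0.
have -> : D x = 2 * phi x * (\sum_i partial i phi x * q i) +
    phi x ^+ 2 * (laplacian u x / u x - s ^+ 2).
  rewrite sE /laplacian mulr_suml -sumrB !mulr_sumr -big_split/=.
  by apply: eq_bigr => i _; rewrite /div_term expr2.
rewrite enorm_gradient; apply => //.
have [_ _ /(_ _ Ox)] := hu.
by rewrite -ler_pdivlMr// mulrDl mulNr mulrA.
Qed.

Lemma weighted_hardy l : 0 < l ->
  \int[lebesgue_rV]_(x in Omega) (c x * phi x ^+ 2) <=
  (1 + l) * (\int[lebesgue_rV]_(x in Omega) (enorm (gradient phi x) ^+ 2)) +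
  (1 + l^-1) * (\int[lebesgue_rV]_(x in Omega) (b x ^+ 2 / 4 * phi x ^+ 2)).
Proof.
move=> l0.
have iA := integrable_gradient_test.
have iB := integrable_mul_test _ within_continuous_sqr_div4.
have iC := integrable_mul_test _ hc.
have iA' : lebesgue_rV.-integrable Omega
    (EFin \o fun x => (1 + l) * enorm (gradient phi x) ^+ 2).
  exact: (integrableZl mOmega (1 + l) iA).
have iB' : lebesgue_rV.-integrable Omega
    (EFin \o fun x => (1 + l^-1) * (b x ^+ 2 / 4 * phi x ^+ 2)).
  exact: (integrableZl mOmega (1 + l^-1) iB).
(* The zero added on the left is replaced by the integral of [D], so that both sides become single
   integrals to be compared pointwise. *)
rewrite -[leLHS]addr0 -integral_D -!RintegralZl// -!RintegralD//.
apply: le_Rintegral => //.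
- exact: (integrableD mOmega iC integrable_D).
- exact: (integrableD mOmega iA' iB').
- by move=> x Ox; exact: log_field_le.
Qed.

End supersolution.

Theorem proposition1 (R : realType) (N : nat) (hN : (3 <= N)%N)
    (Omega : set 'rV[R]_N) (hOmega : domain Omega)
    (b c : 'rV[R]_N -> R)
    (hb : {within Omega, continuous b}) (hc : {within Omega, continuous c})
    (hc0 : forall x, Omega x -> 0 <= c x)
    (hu : exists u : 'rV[R]_N -> R, positive_supersolution Omega b c u)
    (phi : 'rV[R]_N -> R) (hphi : test_function Omega phi) :
  Num.sqrt (\int[lebesgue_rV]_(x in Omega) (c x * phi x ^+ 2)) <=
    Num.sqrt (\int[lebesgue_rV]_(x in Omega) (enorm (gradient phi x) ^+ 2)) +
    Num.sqrt (\int[lebesgue_rV]_(x in Omega) (b x ^+ 2 / 4 * phi x ^+ 2))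
  /\
  \int[lebesgue_rV]_(x in Omega) ((c x - b x ^+ 2 / 4) * phi x ^+ 2) <=
    \int[lebesgue_rV]_(x in Omega) (enorm (gradient phi x) ^+ 2) +
    2 * Num.sqrt
          ((\int[lebesgue_rV]_(x in Omega) (enorm (gradient phi x) ^+ 2)) *
           (\int[lebesgue_rV]_(x in Omega) (b x ^+ 2 / 4 * phi x ^+ 2))).
Proof.
have [_ oOmega _] := hOmega; have [u {}hu] := hu.
set A := \int[lebesgue_rV]_(x in Omega) (enorm (gradient phi x) ^+ 2).
set B := \int[lebesgue_rV]_(x in Omega) (b x ^+ 2 / 4 * phi x ^+ 2).
set C := \int[lebesgue_rV]_(x in Omega) (c x * phi x ^+ 2).
have A0 : 0 <= A by apply: Rintegral_ge0 => x _; exact: sqr_ge0.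
have B0 : 0 <= B.
  by apply: Rintegral_ge0 => x _; rewrite mulr_ge0 ?divr_ge0 ?sqr_ge0.
have CAB : C <= (Num.sqrt A + Num.sqrt B) ^+ 2.
  by apply: le_sqr_sum_sqrt => // l; exact: (weighted_hardy oOmega hb hc hu hphi).
split.
  rewrite -[leRHS]ger0_norm ?addr_ge0 ?sqrtr_ge0// -sqrtr_sqr.
  exact: ler_wsqrtr.
have -> : \int[lebesgue_rV]_(x in Omega) ((c x - b x ^+ 2 / 4) * phi x ^+ 2) = C - B.
  rewrite -RintegralB//.
  - by apply: eq_Rintegral => x _; rewrite mulrBl.
  - exact: open_measurable_rV.
  - exact: (integrable_mul_test oOmega hphi).
  - exact/(integrable_mul_test oOmega hphi)/within_continuous_sqr_div4.
(* Expanding the square in [CAB] gives [C <= A + B + 2 * sqrt (A * B)]; moving [B] to the left gives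
   the second form. *)
rewrite sqrtrM//; move: CAB; rewrite sqrrD !sqr_sqrtr//; lra.
Qed.
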